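(* Let $\alpha\in[0,\infty)$ and let $L$ be the event that $\mathscr{G}(n,\alpha/n)$ contains no cycles. Then the limit below exists and \[ \lim_{n\to\infty}P_{n,\alpha}(L)^{1/n}=\begin{cases}\alpha\exp\bigl(-\tfrac{\alpha}{2}+\tfrac{1}{2\alpha}\bigr), & \text{if }\alpha>1,\\ 1, & \text{otherwise.}\end{cases} \]
   Context: $\mathscr{G}(n,p)$ is the random graph on vertex set $\{1,\dots,n\}$ in which each of the $\binom n2$ unordered pairs is an edge independently with probability $p$; here $p=\alpha/n$, and $P_{n,\alpha}$ is the corresponding probability measure. *)

(* Defs.v *)
From HB Require Import structures.
From mathcomp Require Import all_boot all_order all_algebra.
From mathcomp Require Import all_classical all_reals all_analysis.
Set Implicit Arguments. Unset Strict Implicit. Unset Printing Implicit Defensive.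
Import Order.TTheory GRing.Theory Num.Theory.
Local Open Scope ring_scope.

(* A simple graph on vertex set 'I_n is given by its edge set
   E : {set {set 'I_n}}, a set of 2-element subsets of 'I_n. *)
Definition unordered_pairs (n : nat) : {set {set 'I_n}} :=
  [set e : {set 'I_n} | #|e| == 2%N].

Definition adjb (n : nat) (E : {set {set 'I_n}}) : rel 'I_n :=
  fun x y => [set x; y] \in E.

Definition has_cycle (n : nat) (E : {set {set 'I_n}}) : Prop :=
  exists s : seq 'I_n, [/\ (3 <= size s)%N, uniq s & cycle (adjb E) s].

Definition prob_acyclic (R : realType) (n : nat) (p : R) : R :=
  \sum_(E : {set {set 'I_n}} | E \subset unordered_pairs n)
     (if `[< ~ has_cycle E >] then
        p ^+ #|E| * (1 - p) ^+ (#|unordered_pairs n| - #|E|)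
      else 0).

(* Main.v *)
Require Import Defs.
From HB Require Import structures.
From mathcomp Require Import all_boot all_order all_algebra.
From mathcomp Require Import all_classical all_reals all_analysis.
From mathcomp Require Import ring lra zify.
From mathcomp Require Import fintype finset.
Set Implicit Arguments. Unset Strict Implicit. Unset Printing Implicit Defensive.
Import Order.TTheory GRing.Theory Num.Theory.
Import numFieldNormedType.Exports.
Local Open Scope ring_scope.

(** Write [x = p / (1 - p)]; then [P(L) = (1 + x) ^ - C(n, 2) * Z(0, n)], where
    [Z(k, m)] is the sum of [x ^ |F|] over the forests [F] on [k] active and [m]
    inactive vertices in which distinct active vertices lie in distinct
    components. Removing an active vertex and activating its [j] neighbours gives
    [Z(k + 1, m) = sum_j C(m, j) x ^ j Z(k + j, m - j)], and
    [Z(0, m + 1) = Z(1, m)] since a single active vertex is no constraint. All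
    bounds are sub- or supersolutions of this recursion.

    - Trivially [Z(k, m) <= (1 + x) ^ (k m + C(m, 2))], and if [m p <= a < 1] this
      is sharp up to a factor [exp (- x (A k ^ 2 + B m))]: by Jensen's inequality
      it suffices that the exponent be a supersolution in mean, which holds
      because the number of active vertices has negative drift. For [alpha < 1]
      it follows that [P(L)] is bounded below.
    - [exp (1 / (2 x)) m! (e x) ^ m e ^ k] is a supersolution as long as
      [m x >= 1]; for [k = 0] and [m x <= 1] it dominates the trivial bound. This
      gives the upper bound for [alpha >= 1].
    - For [alpha >= 1], keep only the forests in which the tree of the first vertex
      leaves [m ~ y n / alpha] vertices, with [y < 1] close to [1]. There are
      [(n - m) ^ (n - m - 2)] trees on [n - m] vertices (again by the recursion),
      and the remaining [m] vertices form a subcritical graph. *)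

(** * Separating forests and the removal of an active vertex *)

Definition separating_forest (n : nat) (A : {set 'I_n}) (E : {set {set 'I_n}}) :=
  `[< ~ has_cycle E >] &&
  [forall a in A, forall b in A, connect (adjb E) a b ==> (a == b)].

Definition pairs_within (n : nat) (W : {set 'I_n}) : {set {set 'I_n}} :=
  [set e : {set 'I_n} | (e \subset W) && (#|e| == 2%N)].

Definition neighbours (n : nat) (E : {set {set 'I_n}}) (v : 'I_n) : {set 'I_n} :=
  [set u | [set v; u] \in E].

Definition delete_vertex (n : nat) (E : {set {set 'I_n}}) (v : 'I_n) :=
  [set e in E | v \notin e].

Definition star (n : nat) (v : 'I_n) (J : {set 'I_n}) : {set {set 'I_n}} :=
  [set [set v; u] | u in J].

(** This is [Z] for concrete vertex sets, with [A] active and [V] inactive; by [forest_weightE] only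
    the cardinalities matter when the two are disjoint. *)
Definition forest_weight (R : realType) (x : R) (n : nat) (A V : {set 'I_n}) : R :=
  \sum_(E : {set {set 'I_n}} | (E \subset pairs_within (A :|: V)) &&
                               separating_forest A E) x ^+ #|E|.

Lemma set2_injr (T : finType) (v : T) : injective (fun u => [set v; u]).
Proof.
move=> u w e.
have : u \in [set v; w] by rewrite -e set22.
have : w \in [set v; u] by rewrite e set22.
rewrite !inE => /orP[/eqP-> /orP[/eqP->|/eqP->]|/eqP->] //.
Qed.

Lemma adjb_sym (n : nat) (E : {set {set 'I_n}}) : symmetric (adjb E).
Proof. by move=> u w; rewrite /adjb setUC. Qed.

Lemma connect_adjb_sym (n : nat) (E : {set {set 'I_n}}) : connect_sym (adjb E).
Proof. exact/sym_connect_sym/adjb_sym. Qed.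

Lemma separating_forestP (n : nat) (A : {set 'I_n}) (E : {set {set 'I_n}}) :
  reflect (~ has_cycle E /\
           forall a b, a \in A -> b \in A -> connect (adjb E) a b -> a = b)
          (separating_forest A E).
Proof.
apply: (iffP andP) => [[/asboolP cE /forall_inP sE]|[cE sE]]; split=> //.
- move=> a b aA bA ab; have /forall_inP/(_ _ bA) := sE _ aA.
  by move=> /implyP/(_ ab)/eqP.
- exact/asboolP.
- apply/forall_inP => a aA; apply/forall_inP => b bA; apply/implyP => ab.
  by apply/eqP; apply: sE.
Qed.

Lemma adjb_delete_vertex (n : nat) (E : {set {set 'I_n}}) (v a b : 'I_n) :
  adjb (delete_vertex E v) a b = [&& adjb E a b, v != a & v != b].
Proof. by rewrite /adjb in_set !in_set2 negb_or. Qed.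

Lemma path_delete_vertex (n : nat) (E : {set {set 'I_n}}) (v a : 'I_n) s :
  v \notin a :: s -> path (adjb (delete_vertex E v)) a s = path (adjb E) a s.
Proof.
elim: s a => //= b s IH a; rewrite !inE !negb_or => /and3P[va vb vs].
have vbs : v \notin b :: s by rewrite inE negb_or vb.
by rewrite adjb_delete_vertex va vb !andbT (IH _ vbs).
Qed.

Lemma cycle_delete_vertex (n : nat) (E : {set {set 'I_n}}) (v : 'I_n) s :
  v \notin s -> cycle (adjb (delete_vertex E v)) s = cycle (adjb E) s.
Proof.
case: s => //= a s vs; apply: path_delete_vertex.
by rewrite inE mem_rcons orbA orbb -in_cons.
Qed.

Lemma path_delete_vertexW (n : nat) (E : {set {set 'I_n}}) (v a : 'I_n) s :
  path (adjb (delete_vertex E v)) a s -> path (adjb E) a s.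
Proof.
by apply: sub_path => u w; rewrite adjb_delete_vertex => /and3P[].
Qed.

Lemma connect_delete_vertexW (n : nat) (E : {set {set 'I_n}}) (v a b : 'I_n) :
  connect (adjb (delete_vertex E v)) a b -> connect (adjb E) a b.
Proof.
by apply: connect_sub => u w; rewrite adjb_delete_vertex => /and3P[/connect1].
Qed.

Lemma has_cycle_delete_vertex (n : nat) (E : {set {set 'I_n}}) (v : 'I_n) :
  has_cycle (delete_vertex E v) -> has_cycle E.
Proof.
case=> -[|a s] [s3 us cs] //; exists (a :: s); split => //.
exact: path_delete_vertexW cs.
Qed.

Lemma path_avoids_deleted (n : nat) (E : {set {set 'I_n}}) (v a : 'I_n) s :
  path (adjb (delete_vertex E v)) a s -> v \notin s.
Proof.
elim: s a => //= b s IH a /andP[+ /IH vs].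
by rewrite adjb_delete_vertex inE negb_or vs => /and3P[_ _ ->].
Qed.

(** A path without repetitions leaves [v] at its first step and never returns. *)
Lemma connect_from_deleted (n : nat) (E : {set {set 'I_n}}) (v b : 'I_n) :
  b != v -> connect (adjb E) v b ->
  exists2 j, j \in neighbours E v & connect (adjb (delete_vertex E v)) j b.
Proof.
move=> bv /connectP[s ps eb]; case/shortenP: ps eb => -[|j s'] /= ps us _ eb.
  by rewrite eb eqxx in bv.
case/andP: ps => vj ps; case/andP: us => vs _; exists j; first by rewrite inE.
by apply/connectP; exists s' => //; rewrite path_delete_vertex.
Qed.

Lemma connect_delete_vertex_or (n : nat) (E : {set {set 'I_n}}) (v a b : 'I_n) :
  connect (adjb E) a b ->
  connect (adjb (delete_vertex E v)) a b \/ connect (adjb E) v b.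
Proof.
move=> /connectP[s ps eb]; have [vs|vs] := boolP (v \in a :: s); last first.
  by left; apply/connectP; exists s => //; rewrite path_delete_vertex.
right; case/splitPl: vs ps eb => s1 s2 e1.
rewrite cat_path last_cat e1 => /andP[_ p2] ->.
by apply/connectP; exists s2.
Qed.

(** An edge from [v] to an active vertex, or a path avoiding [v] from a neighbour of [v] to another
    active vertex, would join two active vertices; a path avoiding [v] between two neighbours would
    close a cycle. Conversely, only these configurations can spoil a separating forest when [v] is
    restored. *)
Lemma separating_forest_pop (n : nat) (A V : {set 'I_n}) (E : {set {set 'I_n}})
    (v : 'I_n) :
  v \in A -> [disjoint A & V] -> E \subset pairs_within (A :|: V) ->
  separating_forest A E =
  (neighbours E v \subset V) &&
  separating_forest ((A :\ v) :|: neighbours E v) (delete_vertex E v).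
Proof.
move=> vA dAV EAV.
have vNv : v \notin neighbours E v.
  rewrite inE setUid; apply/negP => /(subsetP EAV).
  by rewrite inE cards1 andbF.
have symE := connect_adjb_sym E.
have symE' := connect_adjb_sym (delete_vertex E v).
apply/separating_forestP/andP => [[cE sE]|[JV /separating_forestP[cE' sE']]].
  have JV : neighbours E v \subset V.
    apply/subsetP => j jJ; have jv : j != v.
      by apply: contraNneq vNv => e; rewrite -{1}e.
    have : [set v; j] \in E by rewrite inE in jJ.
    move=> /(subsetP EAV); rewrite inE => /andP[/subsetP/(_ j)].
    rewrite set22 inE => /(_ isT)/orP[jA _|//].
    have : v = j by apply: sE => //; apply: connect1; rewrite inE in jJ.
    by move=> vj; rewrite vj eqxx in jv.
  split=> //; apply/separating_forestP; split=> [/has_cycle_delete_vertex //|].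
  have mixed a b : a \in A :\ v -> b \in neighbours E v ->
      ~ connect (adjb (delete_vertex E v)) a b.
    rewrite !inE => /andP[av aA] bJ /connect_delete_vertexW ab.
    move: av; rewrite (_ : a = v) ?eqxx //; apply: sE => //.
    by apply: connect_trans ab _; rewrite symE; apply: connect1.
  move=> a b; rewrite !in_setU => /orP[aA|aJ] /orP[bA|bJ] ab.
  - move: aA bA; rewrite !inE => /andP[_ aA] /andP[_ bA].
    exact: sE (connect_delete_vertexW ab).
  - by case: (mixed a b).
  - by case: (mixed b a) => //; rewrite symE'.
  - have [//|ab'] := eqVneq a b; case: cE.
    case/connectP: ab => s ps eb; case/shortenP: ps eb => s' ps' us' _ eb.
    have va : v != a by apply: contraNneq vNv => e; rewrite {1}e.
    (* A path avoiding [v] between two neighbours of [v] closes up through [v]; the cycle has length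
       at least 3 because its ends differ. *)
    exists [:: v, a & s']; split.
    + by case: s' {ps' us'} eb => //= eb; rewrite eb eqxx in ab'.
    + rewrite cons_uniq us' andbT inE negb_or va /=.
      exact: path_avoids_deleted ps'.
    + rewrite /= rcons_path (path_delete_vertexW ps') -eb.
      rewrite !inE in aJ bJ.
      by apply/and3P; split=> //; rewrite adjb_sym.
(* The neighbour [j] through which [v] reaches [b] is active after the deletion, so separation
   forces [j = b]; but [j] lies in [V] and [b] in [A]. *)
have away b : b \in A -> b != v -> connect (adjb E) v b -> False.
  move=> bA bv /(connect_from_deleted bv)[j jJ jb].
  have jb' : j = b by apply: sE' jb; rewrite !in_setU ?jJ ?orbT// !inE bv bA.
  have /(_ _ (subsetP JV _ jJ)) := disjointFl dAV.
  by rewrite jb' bA.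
split=> [[s [s3 us cs]]|a b aA bA ab].
  have [vs|vs] := boolP (v \in s); last first.
    by case: cE'; exists s; split=> //; rewrite cycle_delete_vertex.
  (* Rotated to start at [v], the cycle contains a path avoiding [v] between two neighbours of [v].
     Separation identifies its ends, against uniqueness and length at least 3. *)
  case/rot_to: vs => i s' es.
  have {}us : uniq (v :: s') by rewrite -es rot_uniq.
  have {}cs : cycle (adjb E) (v :: s') by rewrite -es rot_cycle.
  have {s3} : (3 <= size (v :: s'))%N by rewrite -es size_rot.
  case: s' us cs {es} => [//|a s'] us cs s3.
  have vs' : v \notin a :: s' by case/andP: us.
  move: cs; rewrite /= rcons_path => /and3P[va ps sv].
  have e : a = last a s'.
    apply: sE'; rewrite ?in_setU ?inE ?[X in _ || X]va ?orbT //.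
      by move: sv; rewrite adjb_sym /adjb => ->; rewrite orbT.
    by apply/connectP; exists s' => //; rewrite path_delete_vertex.
  case: s' s3 us e {ps vs' sv} => //= b s' _ /and3P[_ + _] e.
  by rewrite {1}e mem_last.
have [av|av] := eqVneq a v.
  by have [->//|bv] := eqVneq b v; case: (away b) => //; rewrite -av.
have [bv|bv] := eqVneq b v.
  by case: (away a) => //; rewrite symE -bv.
have [ab'|vb] := connect_delete_vertex_or v ab; last by case: (away b).
by apply: sE' ab'; rewrite !inE ?av ?bv ?aA ?bA.
Qed.

Lemma delete_vertexK (n : nat) (E : {set {set 'I_n}}) (W : {set 'I_n}) (v : 'I_n) :
  E \subset pairs_within W ->
  delete_vertex E v :|: star v (neighbours E v) = E.
Proof.
move=> EW; apply/setP => e; rewrite in_setU in_set.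
apply/orP/idP => [[/andP[]//|/imsetP[u uN ->]]|eE].
  by rewrite inE in uN.
have [ve|ve] := boolP (v \in e); [right|by left; rewrite eE].
have := subsetP EW _ eE; rewrite in_set => /andP[_ /cards2P[a [b [_ ee]]]].
move: ve eE; rewrite ee in_set2 => /orP[] /eqP <- eE.
  by apply/imsetP; exists b; rewrite ?inE.
by apply/imsetP; exists a; rewrite ?inE 1?setUC.
Qed.

Lemma notin_pairs_within (n : nat) (W : {set 'I_n}) (E : {set {set 'I_n}})
    (v : 'I_n) e :
  v \notin W -> E \subset pairs_within W -> e \in E -> v \notin e.
Proof.
move=> vW EW /(subsetP EW); rewrite inE => /andP[eW _].
by apply: contra vW => /(subsetP eW).
Qed.

(** With [neighbours_add] and [delete_vertexK] this makes an edge set equivalent to the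
    neighbourhood of [v] together with the edges avoiding [v]. *)
Lemma delete_vertex_addK (n : nat) (E : {set {set 'I_n}}) (J W : {set 'I_n})
    (v : 'I_n) :
  v \notin W -> E \subset pairs_within W ->
  delete_vertex (E :|: star v J) v = E.
Proof.
move=> vW EW; apply/setP => e; rewrite in_set in_setU.
apply/andP/idP => [[/orP[//|/imsetP[u _ ->]]]|eE]; first by rewrite set21.
by rewrite eE (notin_pairs_within vW EW eE).
Qed.

Lemma neighbours_add (n : nat) (E : {set {set 'I_n}}) (J W : {set 'I_n})
    (v : 'I_n) :
  v \notin W -> E \subset pairs_within W -> neighbours (E :|: star v J) v = J.
Proof.
move=> vW EW; apply/setP => u; rewrite in_set in_setU.
apply/orP/idP => [[/(notin_pairs_within vW EW)|/imsetP[w wJ /set2_injr->//]]|uJ].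
  by rewrite set21.
by right; apply/imsetP; exists u.
Qed.

Lemma card_add_star (n : nat) (E : {set {set 'I_n}}) (J W : {set 'I_n})
    (v : 'I_n) :
  v \notin W -> E \subset pairs_within W ->
  #|E :|: star v J| = (#|J| + #|E|)%N.
Proof.
move=> vW EW; rewrite cardsU (_ : E :&: star v J = set0) ?cards0 ?subn0.
  by rewrite addnC card_imset //; apply: set2_injr.
apply/setP => e; rewrite in_setI in_set0; apply/andP => -[eE /imsetP[u _ eu]].
by have := notin_pairs_within vW EW eE; rewrite eu set21.
Qed.

(** Edge sets are grouped by the neighbourhood [J] of [v]. The star contributes [x ^+ #|J|], and
    [separating_forest_pop] identifies what is left. *)
Lemma forest_weight_pop (R : realType) (x : R) (n : nat) (A V : {set 'I_n})
    (v : 'I_n) :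
  v \in A -> [disjoint A & V] ->
  forest_weight x A V =
  \sum_(J : {set 'I_n} | J \subset V)
     x ^+ #|J| * forest_weight x ((A :\ v) :|: J) (V :\: J).
Proof.
move=> vA dAV; have vV : v \notin V by rewrite (disjointFr dAV vA).
rewrite /forest_weight (partition_big (fun E => neighbours E v) (fun J => J \subset V)).
  apply: eq_bigr => J JV; rewrite big_distrr /=.
  have eW : (A :\ v :|: J) :|: (V :\: J) = A :\ v :|: V.
    apply/setP => u; rewrite !inE; have := subsetP JV u.
    by case: (u \in J) => [->//|_]; rewrite ?orbT ?orbF.
  have vW : v \notin A :\ v :|: V by rewrite !inE eqxx.
  have sW : A :\ v :|: V \subset A :|: V by rewrite setSU // subD1set.
  rewrite eW (reindex_onto (fun E => E :|: star v J)
                           (fun E => delete_vertex E v)); last first.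
    move=> E /andP[/andP[EAV _] /eqP<-]; exact: delete_vertexK EAV.
  have eP (E : {set {set 'I_n}}) :
      (E :|: star v J \subset pairs_within (A :|: V)) &&
      separating_forest A (E :|: star v J) &&
      (neighbours (E :|: star v J) v == J) &&
      (delete_vertex (E :|: star v J) v == E) =
      (E \subset pairs_within (A :\ v :|: V)) &&
      separating_forest (A :\ v :|: J) E; last first.
    apply: eq_big => E; rewrite eP // => /andP[EW _].
    by rewrite (card_add_star _ vW EW) exprD.
  apply/andP/andP.
    case=> /andP[/andP[EAV]]; rewrite (separating_forest_pop vA dAV EAV).
    move=> /andP[_ +] /eqP eJ /eqP eE; rewrite eJ eE => -> ; split=> //.
    apply/subsetP => e eE'; have := eE'; rewrite -eE inE => /andP[/(subsetP EAV)].
    rewrite !inE => /andP[/subsetP eAV ->] ve; rewrite andbT.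
    apply/subsetP => u ue; have := eAV _ ue; rewrite !inE.
    by have [uv|//] := eqVneq u v; rewrite -uv ue in ve.
  case=> EW sE; have EAV : E :|: star v J \subset pairs_within (A :|: V).
    apply/subsetP => e; rewrite in_setU => /orP[/(subsetP EW)|/imsetP[u uJ ->]].
      by rewrite !inE => /andP[eW' ->]; rewrite (subset_trans eW').
    rewrite inE cards2 subUset !sub1set !inE vA (subsetP JV _ uJ) orbT /=.
    have [vu|//] := eqVneq v u.
    by move: vV; rewrite vu (subsetP JV _ uJ).
  rewrite (separating_forest_pop vA dAV EAV) EAV (neighbours_add _ vW EW).
  by rewrite (delete_vertex_addK _ vW EW) JV sE !eqxx.
by move=> E /andP[EAV]; rewrite (separating_forest_pop vA dAV EAV) => /andP[].
Qed.

(** A single active vertex has nothing to be separated from, so any inactive vertex may serve as the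
    next root. *)
Lemma forest_weight_root (R : realType) (x : R) (n : nat) (V : {set 'I_n})
    (v : 'I_n) :
  v \in V -> forest_weight x set0 V = forest_weight x [set v] (V :\ v).
Proof.
move=> vV; apply: eq_bigl => E; rewrite set0U setD1K //; congr (_ && _).
apply/separating_forestP/separating_forestP => -[cE sE]; split=> // a b.
  by rewrite !inE => /eqP-> /eqP->.
by rewrite inE.
Qed.

Lemma forest_weight0 (R : realType) (x : R) (n : nat) :
  forest_weight x (set0 : {set 'I_n}) set0 = 1.
Proof.
have p0 (E : {set {set 'I_n}}) : (E \subset pairs_within (set0 :|: set0)) = (E == set0).
  rewrite -subset0 (_ : pairs_within _ = set0) //.
  apply/setP => e; rewrite !inE setU0 subset0; apply/negP => /andP[/eqP->].
  by rewrite cards0.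
rewrite /forest_weight (big_pred1 set0) ?cards0 ?expr0 // => E.
rewrite p0 /=; case: eqP => //= ->; apply/separating_forestP; split.
  by case=> -[|a [|b s]] [] //= _ _; rewrite /adjb inE.
by move=> a b; rewrite inE.
Qed.

(** * From vertex sets to cardinalities: the numbers [Z(k, m)] *)

Lemma sum_subset_card (R : realType) (n : nat) (V : {set 'I_n}) (f : nat -> R) :
  \sum_(J : {set 'I_n} | J \subset V) f #|J| =
  \sum_(j < #|V|.+1) 'C(#|V|, j)%:R * f j.
Proof.
rewrite (partition_big (fun J : {set 'I_n} => inord #|J| : 'I_#|V|.+1) xpredT) //=.
apply: eq_bigr => j _; rewrite -cards_draws -sum1_card natr_sum big_distrl /=.
apply: eq_big => J; rewrite ?inE.
  apply/andP/andP => -[JV /eqP ej]; split=> //.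
    by rewrite -ej inordK // ltnS subset_leq_card.
  by apply/eqP/val_inj; rewrite /= ej inordK.
by move=> /andP[JV /eqP<-]; rewrite inordK ?mul1r // ltnS subset_leq_card.
Qed.

(* The recursion for [Z(k, m)] decreases [k + 2 m], which bounds the fuel needed;
   the value [0] without fuel is never reached. *)
Fixpoint forest_sum_fuel (R : realType) (x : R) (f k m : nat) : R :=
  match f, k, m with
  | 0, _, _ => 0
  | f'.+1, 0, 0 => 1
  | f'.+1, 0, m'.+1 => forest_sum_fuel x f' 1 m'
  | f'.+1, k'.+1, _ =>
      \sum_(j < m.+1) 'C(m, j)%:R * (x ^+ j * forest_sum_fuel x f' (k' + j) (m - j))
  end.

Definition forest_sum (R : realType) (x : R) (k m : nat) : R :=
  forest_sum_fuel x (k + m.*2).+1 k m.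

Lemma forest_sum_fuelE (R : realType) (x : R) (f k m : nat) :
  (k + m.*2 < f)%N -> forest_sum_fuel x f k m = forest_sum x k m.
Proof.
have stable f1 f2 : (k + m.*2 < f1)%N -> (k + m.*2 < f2)%N ->
    forest_sum_fuel x f1 k m = forest_sum_fuel x f2 k m.
  elim: f1 f2 k m => [|f1 IH] [|f2] // [|k] [|m] //= lt1 lt2; try by apply: IH; lia.
    by apply: eq_bigr => j _; congr (_ * (_ * _)); apply: IH; have := ltn_ord j; lia.
  by apply: eq_bigr => j _; congr (_ * (_ * _)); apply: IH; have := ltn_ord j; lia.
by move=> ltf; apply: stable.
Qed.

Lemma forest_sum00 (R : realType) (x : R) : forest_sum x 0 0 = 1.
Proof. by []. Qed.

Lemma forest_sum0S (R : realType) (x : R) (m : nat) :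
  forest_sum x 0 m.+1 = forest_sum x 1 m.
Proof. by apply: (@forest_sum_fuelE _ x (0 + m.+1.*2) 1 m); lia. Qed.

Lemma forest_sumS (R : realType) (x : R) (k m : nat) :
  forest_sum x k.+1 m =
  \sum_(j < m.+1) 'C(m, j)%:R * (x ^+ j * forest_sum x (k + j) (m - j)).
Proof.
transitivity (\sum_(j < m.+1) 'C(m, j)%:R *
    (x ^+ j * forest_sum_fuel x (k.+1 + m.*2) (k + j) (m - j))).
  by rewrite /forest_sum; case: m.
apply: eq_bigr => j _; congr (_ * (_ * _)); apply: forest_sum_fuelE.
by have := ltn_ord j; lia.
Qed.

(** The measure [k + 2 m] drops by 1 when a vertex is activated and by [1 + j] when one is removed
    and its [j] neighbours are activated. *)
Lemma exploration_ind (P : nat -> nat -> Prop) :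
  P 0 0 -> (forall m, P 1 m -> P 0 m.+1) ->
  (forall k m, (forall j, (j <= m)%N -> P (k + j)%N (m - j)%N) -> P k.+1 m) ->
  forall k m, P k m.
Proof.
move=> P00 P0S PS k m; have [N] := ubnP (k + m.*2); elim: N k m => // N IH.
case=> [[//|m]|k m] lt; first by apply: P0S; apply: IH; lia.
by apply: PS => j jm; apply: IH; lia.
Qed.

Lemma forest_sum_ge0 (R : realType) (x : R) (k m : nat) :
  0 <= x -> 0 <= forest_sum x k m.
Proof.
move=> x0; move: k m; apply: exploration_ind => [|m|k m IH].
- by rewrite forest_sum00.
- by rewrite forest_sum0S.
- rewrite forest_sumS sumr_ge0 // => j _; rewrite mulr_ge0 // mulr_ge0 ?exprn_ge0 //.
  by rewrite IH // -ltnS.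
Qed.

Lemma forest_weightE (R : realType) (x : R) (n : nat) (A V : {set 'I_n}) :
  [disjoint A & V] -> forest_weight x A V = forest_sum x #|A| #|V|.
Proof.
move eA : #|A| => k; move eV : #|V| => m.
elim/exploration_ind: k / m A V eA eV => [A V /cards0_eq-> /cards0_eq-> _|m IH A V|k m IH A V].
- exact: forest_weight0.
- move=> /cards0_eq-> eV _; have /card_gt0P[v vV] : (0 < #|V|)%N by rewrite eV.
  rewrite (forest_weight_root _ vV) forest_sum0S; apply: IH; rewrite ?cards1 //.
    by move: eV; rewrite (cardsD1 v) vV => -[].
  by rewrite disjoints1 !inE eqxx.
- move=> eA eV dAV; have /card_gt0P[v vA] : (0 < #|A|)%N by rewrite eA.
  rewrite (forest_weight_pop _ vA dAV) forest_sumS -eV.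
  rewrite -(sum_subset_card V (fun j => x ^+ j * forest_sum x (k + j) (#|V| - j))).
  apply: eq_bigr => J JV; congr (_ * _).
  have lt : (#|J| <= m)%N by rewrite -eV subset_leq_card.
  rewrite eV; apply: (IH #|J| lt).
  + have -> : #|A :\ v :|: J| = (#|A :\ v| + #|J|)%N.
      rewrite cardsU (_ : _ :&: J = set0) ?cards0 ?subn0 //.
      apply/setP => u; rewrite !inE; apply/negP => /andP[/andP[_ uA] uJ].
      by have := subsetP JV _ uJ; rewrite (disjointFr dAV uA).
    by congr addn; move: eA; rewrite (cardsD1 v) vA => -[].
  + by rewrite cardsD (setIidPr JV) eV.
  + rewrite -setI_eq0; apply/eqP/setP => u; rewrite !inE.
    case: (u \in J) => //=; case uA : (u \in A); rewrite ?andbF //=.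
    by rewrite (disjointFr dAV uA) andbF.
Qed.

(** With [N = C(n, 2)], each term [p ^ e (1 - p) ^ (N - e)] equals [(1 - p) ^ N x ^ e]. *)
Lemma prob_acyclicE (R : realType) (n : nat) (p : R) :
  p < 1 ->
  prob_acyclic n p = (1 - p) ^+ 'C(n, 2) * forest_sum (p / (1 - p)) 0 n.
Proof.
move=> p1; have q0 : 1 - p != 0 by rewrite gt_eqF // subr_gt0.
have -> : forest_sum (p / (1 - p)) 0 n = forest_weight (p / (1 - p)) set0 [set: 'I_n].
  by rewrite forest_weightE ?cards0 ?cardsT ?card_ord // -setI_eq0 set0I.
have cN : #|unordered_pairs n| = 'C(n, 2) by rewrite card_draws card_ord.
have eU : unordered_pairs n = pairs_within (set0 :|: [set: 'I_n]).
  by apply/setP => e; rewrite !inE set0U subsetT.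
rewrite /prob_acyclic /forest_weight -big_mkcondr big_distrr /=.
apply: eq_big => [E|E /andP[EU _]].
  rewrite -eU; congr (_ && _).
  apply/asboolP/separating_forestP => [cE|[]//]; split=> // a b.
  by rewrite inE.
have := subset_leq_card EU; rewrite cN => le.
rewrite expr_div_n mulrCA; congr (_ * _).
by apply: (canRL (mulfK _)); rewrite ?expf_neq0 // -exprD subnK.
Qed.

(** * Binomial identities, moments and Jensen's inequality *)

Lemma bin2D (i j : nat) : 'C(i + j, 2) = ('C(i, 2) + 'C(j, 2) + i * j)%N.
Proof.
elim: j => [|j IH]; first by rewrite addn0 muln0 !addn0.
by rewrite addnS !binS IH !bin1 mulnS; lia.
Qed.

(** The number [k m + C(m, 2)] counts the pairs that are not both active. When [j] inactive vertices
    join [k] active ones, exactly [k j + C(j, 2)] of these pairs become active on both sides. *)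
Lemma exploration_exponent (k m j : nat) : (j <= m)%N ->
  ((k + j) * (m - j) + 'C(m - j, 2) + (k * j + 'C(j, 2)) = k * m + 'C(m, 2))%N.
Proof.
move=> jm; rewrite -{3 4}(subnK jm) bin2D; nia.
Qed.

Lemma bin2_natr (R : realType) (j : nat) : ('C(j, 2)%:R : R) = j%:R * (j%:R - 1) / 2.
Proof.
elim: j => [|j IH]; first by rewrite bin0n mul0r mul0r.
by rewrite binS bin1 natrD IH -natr1; field.
Qed.

Lemma sum_bin_expr (R : realType) (x : R) (m : nat) :
  \sum_(j < m.+1) 'C(m, j)%:R * x ^+ j = (1 + x) ^+ m.
Proof.
by rewrite exprDn; apply: eq_bigr => j _; rewrite expr1n mul1r mulr_natl.
Qed.

Lemma sum_bin_absorb (R : realType) (m : nat) (f : nat -> R) :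
  \sum_(j < m.+2) 'C(m.+1, j)%:R * (j%:R * f j) =
  m.+1%:R * \sum_(j < m.+1) 'C(m, j)%:R * f j.+1.
Proof.
rewrite big_ord_recl mul0r mulr0 add0r big_distrr; apply: eq_bigr => j _ /=.
rewrite /bump leq0n add1n !mulrA; congr (_ * _).
by rewrite -!natrM mulnC -mul_bin_diag.
Qed.

(** After division by [(1 + x) ^ m] the weights are those of a binomial variable with success
    probability [x / (1 + x)]; this is its mean, cleared of denominators. The second factorial
    moment follows in the same form. *)
Lemma sum_bin_mean (R : realType) (x : R) (m : nat) :
  (\sum_(j < m.+1) 'C(m, j)%:R * (j%:R * x ^+ j)) * (1 + x) =
  m%:R * x * (1 + x) ^+ m.
Proof.
case: m => [|m]; first by rewrite big_ord1 !(mul0r, mulr0).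
rewrite (sum_bin_absorb m (fun j => x ^+ j)) exprSr -(sum_bin_expr x m).
rewrite -!mulrA !big_distrl /= !big_distrr /=; apply: eq_bigr => j _.
by rewrite exprS; ring.
Qed.

Lemma sum_bin_factorial_moment (R : realType) (x : R) (m : nat) :
  (\sum_(j < m.+1) 'C(m, j)%:R * (j%:R * ((j%:R - 1) * x ^+ j))) * (1 + x) ^+ 2 =
  m%:R * (m%:R - 1) * x ^+ 2 * (1 + x) ^+ m.
Proof.
case: m => [|m]; first by rewrite big_ord1 !(mul0r, mulr0).
rewrite (sum_bin_absorb m (fun j => (j%:R - 1) * x ^+ j)).
have -> : \sum_(j < m.+1) 'C(m, j)%:R * ((j.+1%:R - 1) * x ^+ j.+1) =
    x * \sum_(j < m.+1) 'C(m, j)%:R * (j%:R * x ^+ j).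
  by rewrite big_distrr /=; apply: eq_bigr => j _; rewrite -natr1 exprS; ring.
have := sum_bin_mean x m; set M := \sum_(_ < _) _ => eM.
have -> : m.+1%:R * (x * M) * (1 + x) ^+ 2 = m.+1%:R * x * (1 + x) * (M * (1 + x)) by ring.
by rewrite eM [(1 + x) ^+ m.+1]exprS -[m.+1%:R]natr1; ring.
Qed.

(** The tangent of the exponential at [- Y] gives [exp (- y) >= exp (- Y) (1 + Y - y)]; averaging
    leaves a nonnegative linear term. *)
Lemma jensen_expRN (R : realType) (n : nat) (w y : 'I_n -> R) (Y : R) :
  (forall i, 0 <= w i) -> \sum_i w i * y i <= Y * \sum_i w i ->
  expR (- Y) * \sum_i w i <= \sum_i w i * expR (- y i).
Proof.
move=> w0 wY; have eY := expR_ge0 (- Y).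
apply: (@le_trans _ _ (\sum_i w i * (expR (- Y) * (1 + (Y - y i))))); last first.
  apply: ler_sum => i _; rewrite ler_wpM2l //.
  rewrite [X in _ <= expR X](_ : _ = - Y + (Y - y i)); last by ring.
  by rewrite expRD; apply: ler_wpM2l => //; apply: expR_ge1Dx.
have -> : \sum_i w i * (expR (- Y) * (1 + (Y - y i))) =
    expR (- Y) * (\sum_i w i + (Y * \sum_i w i - \sum_i w i * y i)).
  rewrite [Y * _]big_distrr -sumrB -big_split big_distrr /=.
  by apply: eq_bigr => i _; ring.
by rewrite ler_wpM2l // lerDl subr_ge0.
Qed.

(** * The trivial upper bound and the subcritical lower bound *)

Lemma forest_sum_le (R : realType) (x : R) (k m : nat) : 0 <= x ->
  forest_sum x k m <= (1 + x) ^+ (k * m + 'C(m, 2)).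
Proof.
move=> x0; have q1 : 1 <= 1 + x by rewrite lerDl.
elim/exploration_ind: k / m => [|m|k m IH].
- by rewrite forest_sum00.
- by rewrite forest_sum0S mul0n mul1n binS bin1 addnC.
rewrite forest_sumS mulSn -addnA exprD -sum_bin_expr big_distrl /=.
apply: ler_sum => j _; rewrite -mulrA ler_wpM2l // ler_wpM2l ?exprn_ge0 //.
have jm : (j <= m)%N by rewrite -ltnS.
(* Readmitting the pairs that have become active on both sides only enlarges the bound. *)
by rewrite (le_trans (IH j jm)) // -(exploration_exponent k jm) ler_weXn2l ?leq_addr.
Qed.

Lemma expr1Dx_le_expR (R : realType) (x : R) (d : nat) :
  0 <= 1 + x -> (1 + x) ^+ d <= expR (x * d%:R).
Proof.
by move=> x0; rewrite expRM_natr lerXn2r ?nnegrE ?expR_ge0 // expR_ge1Dx.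
Qed.

(** The mean number of activated neighbours is [mu = m x / (1 + x) <= a < 1], so the number of
    active vertices drifts downwards, and the decrease of [A k ^ 2] pays for the pairs lost at each
    removal. The coefficient [2 A + 1/2] of [m] absorbs the terms free of [k]. *)
Lemma forest_sum_ge_subcritical (R : realType) (x a A : R) (k m : nat) :
  0 <= x -> a < 1 -> 1 <= 2 * A * (1 - a) -> m%:R * x <= a * (1 + x) ->
  (1 + x) ^+ (k * m + 'C(m, 2)) *
    expR (- (x * (A * k%:R ^+ 2 + (2 * A + 2^-1) * m%:R))) <= forest_sum x k m.
Proof.
move=> x0 a1 hA; have q1 : 1 <= 1 + x by rewrite lerDl.
have q0 : 0 < 1 + x by apply: lt_le_trans q1.
have A0 : 0 <= A by nra.
elim/exploration_ind: k / m => [_|m IH ma|k m IH ma].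
- by rewrite forest_sum00 !(expr0n, mulr0, addr0, oppr0) expR0 mulr1.
- rewrite forest_sum0S; apply: le_trans (IH _); last first.
    by apply: le_trans ma; rewrite ler_wpM2r // ler_nat.
  have -> : (0 * m.+1 + 'C(m.+1, 2) = 1 * m + 'C(m, 2))%N by rewrite binS bin1; lia.
  rewrite ler_wpM2l ?exprn_ge0 ?(ltW q0) // ler_expR.
  by rewrite -[m.+1%:R]natr1 lerN2 ler_wpM2l // expr1n expr0n /= mulr0 add0r; lra.
rewrite forest_sumS.
(* [y j] is the total loss in the branch with [j] neighbours: the [k j + C(j, 2)] lost pairs,
   bounded by [1 + x <= exp x], plus the loss from the induction hypothesis. [Y] is the loss allowed
   by the claim. *)
pose y (j : nat) := x * (k * j + 'C(j, 2))%:R +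
  x * (A * (k + j)%:R ^+ 2 + (2 * A + 2^-1) * (m - j)%:R).
pose w (j : nat) := 'C(m, j)%:R * x ^+ j.
pose Y := x * (A * k.+1%:R ^+ 2 + (2 * A + 2^-1) * m%:R).
have w0 j : 0 <= w j by rewrite mulr_ge0 // exprn_ge0.
have sw : \sum_(j < m.+1) w j = (1 + x) ^+ m by exact: sum_bin_expr.
apply: (@le_trans _ _ ((1 + x) ^+ (k * m + 'C(m, 2)) *
    \sum_(j < m.+1) w j * expR (- y j))); last first.
  rewrite big_distrr; apply: ler_sum => j _ /=.
  have jm : (j <= m)%N by rewrite -ltnS.
  rewrite mulrCA /w -!mulrA ler_wpM2l // ler_wpM2l ?exprn_ge0 //.
  apply: le_trans (IH j jm _); last first.
    by apply: le_trans ma; rewrite ler_wpM2r // ler_nat leq_subr.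
  rewrite /y opprD expRD mulrA ler_wpM2r ?expR_ge0 //.
  rewrite -(exploration_exponent k jm) exprD -mulrA ler_piMr ?exprn_ge0 ?(ltW q0) //.
  by rewrite expRN -ler_pdivlMr ?invr_gt0 ?expR_gt0 // invrK mul1r expr1Dx_le_expR // ltW.
rewrite mulSn -addnA [(m + _)%N]addnC exprD -mulrA ler_wpM2l ?exprn_ge0 ?(ltW q0) //.
rewrite mulrC -sw; apply: jensen_expRN => // {IH}.
rewrite sw; set S := (1 + x) ^+ m; have S0 : 0 < S by rewrite exprn_gt0.
pose mu := m%:R * x / (1 + x).
have mu0 : 0 <= mu by rewrite divr_ge0 ?mulr_ge0 ?(ltW q0).
have mua : mu <= a by rewrite ler_pdivrMr.
set M1 := \sum_(j < m.+1) 'C(m, j)%:R * (j%:R * x ^+ j).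
set M2 := \sum_(j < m.+1) 'C(m, j)%:R * (j%:R * ((j%:R - 1) * x ^+ j)).
have eM1 : M1 = mu * S.
  have := sum_bin_mean x m; rewrite -/M1 -/S => /(canRL (mulfK (lt0r_neq0 q0))) ->.
  by rewrite /mu; field; rewrite lt0r_neq0.
have leM2 : M2 <= mu ^+ 2 * S.
  have := sum_bin_factorial_moment x m; rewrite -/M2 -/S.
  move=> /(canRL (mulfK (expf_neq0 2 (lt0r_neq0 q0)))) ->.
  have -> : mu ^+ 2 * S = m%:R ^+ 2 * x ^+ 2 * S / (1 + x) ^+ 2.
    by rewrite /mu; field; rewrite lt0r_neq0.
  rewrite ler_wpM2r ?invr_ge0 ?exprn_ge0 ?(ltW q0) //.
  rewrite ler_wpM2r ?(ltW S0) // ler_wpM2r ?exprn_ge0 //.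
  by have := ler0n R m; nra.
have -> : \sum_(j < m.+1) w j * y j =
    x * ((A * k%:R ^+ 2 + (2 * A + 2^-1) * m%:R) * S +
         (k%:R + 2 * A * k%:R - A - 2^-1) * M1 + (A + 2^-1) * M2).
  rewrite /S -sw /M1 /M2 !big_distrr -!big_split big_distrr /=.
  apply: eq_bigr => j _; have jm : (j <= m)%N by rewrite -ltnS.
  by rewrite /w /y !natrD natrM natrB // bin2_natr; field.
rewrite /Y -[X in _ <= X]mulrA ler_wpM2l // eM1 -[k.+1%:R]natr1.
have k0 := ler0n R k; have m0 := ler0n R m.
apply: (@le_trans _ _ ((A * k%:R ^+ 2 + (2 * A + 2^-1) * m%:R +
   (k%:R + 2 * A * k%:R - A - 2^-1) * mu + (A + 2^-1) * mu ^+ 2) * S)).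
  have := ler_wpM2l (_ : 0 <= A + 2^-1) leM2.
  by rewrite addr_ge0 // => /(_ isT); lra.
rewrite ler_wpM2r ?(ltW S0) //.
(* The condition on [A] gives [a (1 + 2 A) <= 2 A], which settles the terms linear in [k]. The terms
   free of [k] on the left amount to [(A + 1/2) (mu ^ 2 - mu) <= 0]. *)
have h1 : mu * (1 + 2 * A) <= 2 * A by nra.
have h2 : k%:R * (mu * (1 + 2 * A)) <= k%:R * (2 * A) by rewrite ler_wpM2l.
have h3 : mu ^+ 2 <= mu by rewrite expr2; nra.
by nra.
Qed.

(** * Lower bound by counting rooted forests *)

Lemma bin_trinomial (m s j : nat) : (j <= s)%N ->
  ('C(m + s, j) * 'C(m + s - j, s - j) = 'C(m + s, s) * 'C(s, j))%N.
Proof.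
move=> js; have f0 := (fact_gt0 j, fact_gt0 (s - j), fact_gt0 m).
apply/eqP; rewrite -(@eqn_pmul2r (j`! * (s - j)`! * m`!)) ?muln_gt0 ?f0 //.
have e1 := @bin_fact (m + s) j; have e2 := @bin_fact (m + s - j) (s - j).
have e3 := @bin_fact (m + s) s; have e4 := bin_fact js.
have {}e1 := e1 (leq_trans js (leq_addl m s)).
have {}e2 := e2 (leq_sub2r j (leq_addl m s)).
have {}e3 := e3 (leq_addl m s).
rewrite (_ : m + s - j - (s - j) = m)%N in e2; last by lia.
rewrite addnK in e3.
apply/eqP; transitivity (m + s)`!.
  by rewrite -e1 -e2; ring.
by rewrite -e3 -e4; ring.
Qed.

(** For [c = k] and [N = k + s + 1] the right-hand side is [N (k + 1) (N + 1) ^ s], so this is the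
    recursion for the rooted forest counts. *)
Lemma sum_bin_rooted (R : realType) (N c : R) (s : nat) :
  \sum_(j < s.+2) 'C(s.+1, j)%:R * ((c + j%:R) * N ^+ (s.+1 - j)) =
  c * (N + 1) ^+ s.+1 + s.+1%:R * (N + 1) ^+ s.
Proof.
have -> : \sum_(j < s.+2) 'C(s.+1, j)%:R * ((c + j%:R) * N ^+ (s.+1 - j)) =
    c * \sum_(j < s.+2) 'C(s.+1, j)%:R * N ^+ (s.+1 - j) +
    \sum_(j < s.+2) 'C(s.+1, j)%:R * (j%:R * N ^+ (s.+1 - j)).
  by rewrite big_distrr -big_split; apply: eq_bigr => j _ /=; ring.
have sb r : \sum_(j < r.+1) 'C(r, j)%:R * N ^+ (r - j) = (N + 1) ^+ r.
  by rewrite exprDn; apply: eq_bigr => j _; rewrite expr1n mulr1 mulr_natl.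
by rewrite sb (sum_bin_absorb s (fun j => N ^+ (s.+1 - j))) sb.
Qed.

Lemma forest_sum_ge0l (R : realType) (x : R) (k m : nat) : 0 <= x ->
  forest_sum x 0 m <= forest_sum x k m.
Proof.
move=> x0; elim: k => // k IH; apply: le_trans IH _.
rewrite forest_sumS big_ord_recl bin0 expr0 !mul1r addn0 subn0 lerDl.
by apply: sumr_ge0 => j _; rewrite !mulr_ge0 ?exprn_ge0 ?forest_sum_ge0.
Qed.

(* [k * (k + s) ^ (s - 1)] is the number of forests on [k + s] vertices whose
   components each contain exactly one of [k] given roots. *)
Lemma forest_sum_ge_rooted (R : realType) (x : R) (k s m : nat) :
  0 <= x -> (0 < k + s)%N ->
  'C(m + s, s)%:R * x ^+ s * (k%:R * (k + s)%:R ^+ s / (k + s)%:R) * forest_sum x 0 m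
    <= forest_sum x k (m + s).
Proof.
move=> x0; elim/exploration_ind: k / s => [//|s _ _|k s IH _].
  by rewrite !(mul0r, mulr0) forest_sum_ge0.
(* For [s = 0] the quotient is 1; the division avoids an exponent [s - 1]. *)
case: s IH => [|s] IH.
  by rewrite !addn0 bin0 !expr0 !mulr1 divff ?mul1r ?forest_sum_ge0l.
set N : R := (k + s.+1)%:R.
have ks0 : (0 < k + s.+1)%N by rewrite addnS.
have N0 : N != 0 by rewrite pnatr_eq0 -lt0n.
have -> : (k.+1%:R * (k.+1 + s.+1)%:R ^+ s.+1 / (k.+1 + s.+1)%:R : R) =
    (\sum_(j < s.+2) 'C(s.+1, j)%:R * ((k%:R + j%:R) * N ^+ (s.+1 - j))) / N.
  rewrite sum_bin_rooted addSn -[(k + s.+1).+1%:R]natr1 -/N.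
  have N1 : N + 1 != 0 by rewrite natr1 pnatr_eq0.
  rewrite exprS /N natrD -[k.+1%:R]natr1 -[s.+1%:R]natr1; field.
  move: N0 N1; rewrite /N natrD -[s.+1%:R]natr1 => N0 N1.
  by rewrite ?N0 ?N1.
rewrite forest_sumS.
(* Terms with [j > s + 1] are dropped: in the forests that are kept, the neighbours of the removed
   root lie among the [s + 1] vertices attached to the roots. *)
apply: (@le_trans _ _ (\sum_(j < s.+2) 'C(m + s.+1, j)%:R *
    (x ^+ j * forest_sum x (k + j) (m + s.+1 - j)))); last first.
  rewrite -(big_mkord xpredT (fun j => 'C(m + s.+1, j)%:R *
    (x ^+ j * forest_sum x (k + j) (m + s.+1 - j)))).
  rewrite -[X in _ <= X](big_mkord xpredT (fun j => 'C(m + s.+1, j)%:R *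
    (x ^+ j * forest_sum x (k + j) (m + s.+1 - j)))).
  rewrite (@big_cat_nat _ _ _ s.+2 0 (m + s.+1).+1) //=; last by rewrite ltnS leq_addl.
  by rewrite lerDl sumr_ge0 // => j _; rewrite !mulr_ge0 ?exprn_ge0 ?forest_sum_ge0.
rewrite mulrAC; set K := 'C(m + s.+1, s.+1)%:R * x ^+ s.+1 * forest_sum x 0 m.
rewrite [_ / N]mulrC mulrA big_distrr /= {}/K; apply: ler_sum => j _.
have js : (j <= s.+1)%N by rewrite -ltnS.
have := IH j js; rewrite -addnA subnKC // -addnBA // => /(_ ks0).
move=> h; rewrite -/N natrD in h.
apply: le_trans (ler_wpM2l _ (ler_wpM2l _ h)); rewrite ?exprn_ge0 //.
(* Choosing the [j] neighbours and then the other attached vertices amounts to choosing all attached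
   vertices and then the neighbours among them. *)
have := bin_trinomial m js; rewrite addnBA // => /(congr1 (fun i => i%:R : R)).
rewrite !natrM => e.
have ex : x ^+ s.+1 = x ^+ j * x ^+ (s.+1 - j) by rewrite -exprD subnKC.
rewrite le_eqVlt; apply/orP; left; apply/eqP; rewrite ex.
transitivity (('C(m + s.+1, s.+1)%:R * 'C(s.+1, j)%:R) * x ^+ j * x ^+ (s.+1 - j) *
   forest_sum x 0 m * ((k%:R + j%:R) * N ^+ (s.+1 - j)) / N); first by ring.
by rewrite -e; ring.
Qed.

(** * Factorial estimates and the upper bound for [Z] *)

Lemma sum_inv_fact_le (R : realType) (m : nat) :
  \sum_(j < m.+1) (j`!%:R)^-1 <= expR (1 : R).
Proof.
have -> : \sum_(j < m.+1) (j`!%:R)^-1 = series (exp_coeff (1 : R)) m.+1.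
  rewrite /series /= big_mkord; apply: eq_bigr => j _.
  by rewrite exp_coeffE expr1n mulr1.
apply: nondecreasing_cvgn_le; last exact: is_cvg_series_exp_coeff.
apply: (@nondecreasing_series R (exp_coeff 1) xpredT) => i _ _.
exact: exp_coeff_ge0.
Qed.

(** The quotient [n ^ n / n!] is one term of the series of [exp n]. *)
Lemma exprn_le_fact (R : realType) (n : nat) :
  n%:R ^+ n <= expR (n%:R : R) * n`!%:R.
Proof.
case: n => [|n]; first by rewrite expr0 expR0 mulr1.
have f0 : 0 < (n.+1)`!%:R :> R by rewrite ltr0n fact_gt0.
rewrite -ler_pdivrMr //; apply: le_trans (expR_ge1Dxn n (ler0n R n.+1)).
by rewrite lerDr.
Qed.

(** A weak Stirling bound, whose polynomial factor disappears under nth roots. The induction rests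
    on [(1 - 1 / (n + 2)) ^ (n + 2) <= 1 / e]. *)
Lemma fact_le_exprn (R : realType) (n : nat) :
  expR (n%:R : R) * n`!%:R <= expR 1 * n.+1%:R * n%:R ^+ n.
Proof.
case: n => [|n]; first by rewrite expR0 expr0 !mulr1 ltW // expR_gt1.
(* For positive arguments the factor can be the argument itself; the extra 1 covers only the
   argument 0. *)
suff h : expR (n.+1%:R : R) * (n.+1)`!%:R <= expR 1 * n.+1%:R * n.+1%:R ^+ n.+1.
  apply: le_trans h _; rewrite ler_wpM2r ?exprn_ge0 // ler_wpM2l ?expR_ge0 //.
  by rewrite ler_nat.
elim: n => [|n IH]; first by rewrite expr1 !mulr1.
rewrite factS natrM -[n.+2%:R in X in X <= _]natr1 expRD natr1.
have -> : expR n.+1%:R * expR 1 * (n.+2%:R * (n.+1)`!%:R) =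
   n.+2%:R * expR 1 * (expR n.+1%:R * (n.+1)`!%:R) :> R by ring.
apply: le_trans (ler_wpM2l _ IH) _; first by rewrite mulr_ge0 // expR_ge0.
have -> : n.+2%:R * expR 1 * (expR 1 * n.+1%:R * n.+1%:R ^+ n.+1) =
   (expR 1 * n.+2%:R) * (expR 1 * n.+1%:R ^+ n.+2) :> R by rewrite [_ ^+ n.+2]exprS; ring.
rewrite ler_wpM2l ?mulr_ge0 ?expR_ge0 //.
have n2 : 0 < n.+2%:R :> R by [].
have h : n.+1%:R / n.+2%:R <= expR (- n.+2%:R^-1) :> R.
  apply: le_trans (expR_ge1Dx _).
  by rewrite ler_pdivrMr // mulrDl mulNr mulVf ?gt_eqF // mul1r -[n.+2%:R]natr1; lra.
have {}h : (n.+1%:R / n.+2%:R) ^+ n.+2 <= expR (- n.+2%:R^-1) ^+ n.+2 :> R.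
  by rewrite lerXn2r ?nnegrE ?expR_ge0 // divr_ge0.
rewrite -expRM_natr mulNr mulVf ?gt_eqF // expRN expr_div_n in h.
rewrite ler_pdivrMr ?exprn_gt0 // in h.
by rewrite mulrC -ler_pdivlMr ?expR_gt0 // mulrC.
Qed.

(** The function [2 ln y - y + 1 / y] vanishes at 1 and has derivative [- (1 / y - 1) ^ 2 <= 0]. *)
Lemma ln_ge_half_subV (R : realType) (y : R) : 0 < y <= 1 -> y - y^-1 <= 2 * ln y.
Proof.
move=> /andP[y0 y1].
pose f : R -> R := ((2 *: (@ln R)) - id) + (fun u : R => u^-1).
have fE u : f u = 2 * ln u - u + u^-1 by [].
have df (t : R) : 0 < t -> is_derive t 1 f (2 * t^-1 - 1 - t^-2).
  move=> t0; have tn : t != 0 by rewrite gt_eqF.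
  have := is_derive1_ln t0 => dl.
  have dv : is_derive t 1 (fun u : R => u^-1) (- t ^- 2 *: 1) by apply: is_deriveV.
  apply: is_derive_eq.
  by rewrite /GRing.scale /=; ring.
have : f 1 <= f y.
  apply: (@ler0_derive1_le_cc R f y 1).
  - by move=> t; rewrite in_itv /= => /andP[yt _]; have /df[] := lt_trans y0 yt.
  - move=> t; rewrite in_itv /= => /andP[yt _]; have t0 := lt_trans y0 yt.
    have [_ e] := df t t0; rewrite derive1E e.
    have -> : 2 / t - 1 - t ^- 2 = - (t^-1 - 1) ^+ 2 by field; rewrite gt_eqF.
    by rewrite oppr_le0 sqr_ge0.
  - apply: derivable_within_continuous => t; rewrite in_itv /= => /andP[yt _].
    by have [] := df t (lt_le_trans y0 yt).
  - by rewrite in_itv /= y1 lexx.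
  - by rewrite in_itv /= y1 lexx.
  - exact: y1.
by rewrite !fE ln1 invr1; lra.
Qed.

(** Removing an active vertex multiplies the bound by the sum of [1 / j!], at most [e], which
    [e ^ k] provides. Activating a vertex is covered when [(m + 1) x >= 1], since this is the ratio
    of the two bounds; otherwise the trivial bound takes over. *)
Lemma forest_sum_le_expR (R : realType) (x : R) (k m : nat) : 0 < x ->
  forest_sum x k m <=
  expR ((2 * x)^-1) * (m`!%:R * (expR 1 * x) ^+ m) * expR k%:R.
Proof.
move=> x0; have e0 := expR_gt0 (1 : R); have D0 := expR_ge0 ((2 * x)^-1).
elim/exploration_ind: k / m => [|m IH|k m IH].
- by rewrite forest_sum00 expR0 expr0 !mulr1 -expR0 ler_expR invr_ge0 mulr_ge0 // ltW.
- rewrite expR0 mulr1; have [mx|mx] := leP 1 (m.+1%:R * x).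
    rewrite forest_sum0S; apply: le_trans IH _.
    rewrite factS natrM exprS.
    have -> : expR (2 * x)^-1 * (m.+1%:R * m`!%:R * (expR 1 * x * (expR 1 * x) ^+ m)) =
       (expR (2 * x)^-1 * (m`!%:R * (expR 1 * x) ^+ m) * expR 1) * (m.+1%:R * x) by ring.
    by rewrite ler_peMr // !mulr_ge0 ?exprn_ge0 ?expR_ge0 ?(ltW x0) // mulr_ge0 ?ltW.
  (* With [n = m + 1] and [y = n x < 1], the claim reduces to [n y / 2 - 1 / (2 x) <= n ln y]. As
     [1 / x = n / y], this is [ln_ge_half_subV], and it accounts for the prefactor
     [exp (1 / (2 x))]. *)
  set y := m.+1%:R * x in mx; have y0 : 0 < y by rewrite mulr_gt0.
  apply: le_trans (forest_sum_le 0 m.+1 (ltW x0)) _.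
  rewrite mul0n add0n.
  apply: le_trans (expr1Dx_le_expR _ (addr_ge0 ler01 (ltW x0))) _.
  have hf : (m.+1%:R * x) ^+ m.+1 <= (m.+1)`!%:R * (expR 1 * x) ^+ m.+1.
    rewrite !exprMn mulrA ler_wpM2r ?exprn_ge0 ?(ltW x0) //.
    by rewrite -expRM_natl mulr1 mulrC exprn_le_fact.
  apply: le_trans (ler_wpM2l D0 hf).
  have ly := ln_ge_half_subV (_ : 0 < y <= 1); rewrite y0 (ltW mx) in ly.
  have {}ly := ly isT.
  rewrite -/y -[y in y ^+ _]lnK ?posrE // -expRM_natl -expRD ler_expR.
  have h : m.+1%:R * (y - y^-1) <= m.+1%:R * (2 * ln y) by rewrite ler_wpM2l.
  have h1 : m.+1%:R * y^-1 = x^-1.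
    by rewrite /y invfM mulrA divff ?mul1r // pnatr_eq0.
  have h2 : (2 * x)^-1 = x^-1 / 2 by rewrite invfM mulrC.
  rewrite mulrBr h1 in h.
  rewrite bin2_natr h2 (_ : x * _ = m.+1%:R * y / 2 - y / 2); last by rewrite /y; field.
  lra.
rewrite forest_sumS -[k.+1%:R]natr1 expRD.
apply: (@le_trans _ _ ((expR (2 * x)^-1 * (m`!%:R * (expR 1 * x) ^+ m) * expR k%:R) *
   \sum_(j < m.+1) (j`!%:R)^-1)); last first.
  rewrite !mulrA ler_wpM2l ?sum_inv_fact_le //.
  by rewrite !mulr_ge0 ?exprn_ge0 ?expR_ge0 ?mulr_ge0 ?(ltW x0) // ltW.
rewrite big_distrr; apply: ler_sum => j _ /=.
have jm : (j <= m)%N by rewrite -ltnS.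
apply: le_trans (ler_wpM2l _ (ler_wpM2l _ (IH j jm))) _; rewrite ?exprn_ge0 ?(ltW x0) //.
rewrite le_eqVlt; apply/orP; left; apply/eqP.
have -> : (expR 1 * x) ^+ m = (expR 1 * x) ^+ (m - j) * (expR j%:R * x ^+ j).
  by rewrite -[j%:R in RHS]mulr1 expRM_natl -exprMn -exprD subnK.
rewrite -(bin_fact jm) !natrM natrD expRD.
have jf : j`!%:R != 0 :> R by rewrite pnatr_eq0 -lt0n fact_gt0.
by field.
Qed.

(** Absorbs polynomial factors into an arbitrarily small exponential rate, through
    [n + 1 <= (1 + 1 / eps) (1 + eps n)]. *)
Lemma natr1_le_expR (R : realType) (eps : R) (n : nat) : 0 < eps ->
  n.+1%:R <= expR (ln (1 + eps^-1) + eps * n%:R).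
Proof.
move=> e0; have ie : 0 < eps^-1 by rewrite invr_gt0.
rewrite expRD lnK ?posrE ?addr_gt0 //.
apply: le_trans (ler_wpM2l _ (expR_ge1Dx _)); last by rewrite addr_ge0 // ltW.
rewrite -natr1 mulrDl mul1r mulrDr mulr1 mulrA mulVf ?gt_eqF // mul1r.
have : 0 <= eps * n%:R by rewrite mulr_ge0 // ltW.
by lra.
Qed.

(** * Bounds on the probability of being acyclic *)

Lemma odds_shift (R : realType) (p : R) : p < 1 -> 1 + p / (1 - p) = (1 - p)^-1.
Proof. by move=> p1; field; rewrite subr_eq0 gt_eqF. Qed.

Lemma prob_acyclic_le1 (R : realType) (n : nat) (p : R) : 0 <= p < 1 ->
  prob_acyclic n p <= 1.
Proof.
move=> /andP[p0 p1]; have q0 : 0 < 1 - p by rewrite subr_gt0.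
have x0 : 0 <= p / (1 - p) by rewrite divr_ge0 // ltW.
rewrite prob_acyclicE //; apply: le_trans (ler_wpM2l _ (forest_sum_le 0 n x0)) _.
  by rewrite exprn_ge0 // ltW.
by rewrite mul0n add0n odds_shift // exprVn divff // expf_neq0 // gt_eqF.
Qed.

(** Since [n p = alpha], the drift condition holds with equality for [a = alpha], and
    [A = 1 / (2 (1 - alpha))] is the least admissible value. The powers of [1 - p] cancel, and
    [p <= alpha] bounds the remaining exponent uniformly in [n]. *)
Lemma prob_acyclic_ge_subcritical (R : realType) (n : nat) (alpha : R) :
  0 <= alpha < 1 -> (0 < n)%N ->
  expR (- (alpha / (1 - alpha) * ((1 - alpha)^-1 + 2^-1))) <=
  prob_acyclic n (alpha / n%:R).
Proof.
move=> /andP[a0 a1] n0; have n1 : 1 <= n%:R :> R by rewrite ler1n.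
set p := alpha / n%:R.
have np : n%:R * p = alpha by rewrite /p mulrC divfK // pnatr_eq0 -lt0n.
have p0 : 0 <= p by rewrite divr_ge0.
have pa : p <= alpha by rewrite -np; nra.
have p1 : p < 1 by apply: le_lt_trans a1.
have q0 : 0 < 1 - p by rewrite subr_gt0.
have b0 : 0 < 1 - alpha by rewrite subr_gt0.
have x0 : 0 <= p / (1 - p) by rewrite divr_ge0 // ltW.
have nx : n%:R * (p / (1 - p)) = alpha * (1 + p / (1 - p)).
  by rewrite odds_shift // mulrA np.
have hA : 1 <= 2 * ((2 * (1 - alpha))^-1) * (1 - alpha).
  by rewrite le_eqVlt; apply/orP; left; apply/eqP; field; rewrite gt_eqF.
have := forest_sum_ge_subcritical 0 x0 a1 hA (_ : _ <= _).
move=> /(_ n); rewrite nx => /(_ (lexx _)) hZ.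
rewrite prob_acyclicE //.
apply: le_trans (ler_wpM2l _ hZ); last by rewrite exprn_ge0 // ltW.
rewrite mul0n add0n odds_shift // mulrA exprVn divff ?mul1r; last first.
  by rewrite expf_neq0 // gt_eqF.
rewrite ler_expR lerN2 expr0n /= mulr0 add0r.
have -> : 2 * (2 * (1 - alpha))^-1 + 2^-1 = (1 - alpha)^-1 + 2^-1.
  by field; rewrite gt_eqF.
rewrite mulrCA mulrC [p / _ * _]mulrC nx odds_shift // ler_wpM2r //.
  by rewrite addr_ge0 ?invr_ge0 // ltW.
by rewrite ler_wpM2l // lef_pV2 ?posrE //; lra.
Qed.

Lemma prob_acyclic_le_supercritical (R : realType) (n : nat) (alpha : R) :
  0 < alpha -> alpha < n%:R -> (3 <= n)%N ->
  prob_acyclic n (alpha / n%:R) <=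
  n.+1%:R * expR (1 + alpha * 3 / 2 +
                  n%:R * (ln alpha - alpha / 2 + (2 * alpha)^-1)).
Proof.
move=> a0 an n3; have n0 : 0 < n%:R :> R by apply: lt_trans an.
set p := alpha / n%:R.
have np : n%:R * p = alpha by rewrite /p mulrC divfK // gt_eqF.
have p0 : 0 < p by rewrite divr_gt0.
have p1 : p < 1 by rewrite ltr_pdivrMr // mul1r.
clearbody p.
have q0 : 0 < 1 - p by rewrite subr_gt0.
have x0 : 0 < p / (1 - p) by rewrite divr_gt0.
rewrite prob_acyclicE //.
apply: le_trans (ler_wpM2l _ (forest_sum_le_expR 0 n x0)) _.
  by rewrite exprn_ge0 // ltW.
rewrite expR0 mulr1.
(* The factor [x ^ n] carries [(1 - p) ^ - n], to be cancelled against [(1 - p) ^ C(n, 2)]; this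
   needs [n >= 3]. *)
have nC : (n <= 'C(n, 2))%N.
  by case: n n3 {n0 an np p p0 p1 q0 x0} => [|[|[|n]]] // _; rewrite (binS n.+2) (binS n.+1) !bin1; lia.
have -> : (1 - p) ^+ 'C(n, 2) *
    (expR (2 * (p / (1 - p)))^-1 * (n`!%:R * (expR 1 * (p / (1 - p))) ^+ n)) =
    (1 - p) ^+ ('C(n, 2) - n) * expR (2 * (p / (1 - p)))^-1 *
    (expR n%:R * n`!%:R * p ^+ n).
  have qn0 : (1 - p) ^+ n != 0 by rewrite expf_neq0 // gt_eqF.
  rewrite -{1}(subnK nC) exprD [X in _ * (_ * (_ * X))]exprMn -expRM_natl mulr1.
  by rewrite expr_div_n; move: (expR _^-1) qn0 (_ ^+ (_ - _)) => D qn0 Q; field.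
have h1 : (1 - p) ^+ ('C(n, 2) - n) <= expR (- p * ('C(n, 2) - n)%:R).
  by apply: expr1Dx_le_expR; rewrite ltW.
have h2 : expR (2 * (p / (1 - p)))^-1 <= expR (n%:R / (2 * alpha)).
  rewrite ler_expR -np.
  have -> : (2 * (p / (1 - p)))^-1 = (2 * p)^-1 - 2^-1 by field; rewrite !gt_eqF.
  have -> : n%:R / (2 * (n%:R * p)) = (2 * p)^-1 by field; rewrite !gt_eqF.
  by rewrite gerBl.
have h3 : expR n%:R * n`!%:R * p ^+ n <= expR 1 * n.+1%:R * alpha ^+ n.
  rewrite -np exprMn [X in _ <= X]mulrA ler_wpM2r ?exprn_ge0 ?(ltW p0) //.
  exact: fact_le_exprn.
apply: le_trans (ler_pM _ _ (ler_pM _ _ h1 h2) h3) _.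
- by rewrite mulr_ge0 ?expR_ge0 // exprn_ge0 // ltW.
- by rewrite !mulr_ge0 ?expR_ge0 // exprn_ge0 // ltW.
- by rewrite exprn_ge0 // ltW.
- exact: expR_ge0.
rewrite -[alpha in alpha ^+ n]lnK ?posrE // -expRM_natl.
rewrite -expRD mulrC -!mulrA mulrCA -!expRD ler_wpM2l // ler_expR.
rewrite natrB // bin2_natr.
have -> : - p * (n%:R * (n%:R - 1) / 2 - n%:R) = - (n%:R * p) * (n%:R - 3) / 2 by field.
rewrite np le_eqVlt; apply/orP; left; apply/eqP; field.
by rewrite gt_eqF.
Qed.

(** Stirling's bounds for [n!], [m!] and [(s + 1)!], where [n = m + s + 1]: the powers of [e] cancel
    up to a constant, and [m ^ m <= (n / alpha) ^ m] produces [alpha ^ m]. *)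
Lemma bin_rooted_ge (R : realType) (alpha : R) (m s : nat) :
  1 <= alpha -> m%:R * alpha <= (m + s).+1%:R ->
  alpha ^+ (m + s) <= expR 2 * (m + s).+2%:R ^+ 4 *
   ('C(m + s, s)%:R * (alpha / (m + s).+1%:R) ^+ s * (s.+1%:R ^+ s / s.+1%:R)).
Proof.
move=> a1 mn; set n := (m + s).+1 in mn *.
have a0 : 0 < alpha by apply: lt_le_trans a1.
have n0 : 0 < n%:R :> R by [].
have sn : (s.+1 <= n.+1)%N by rewrite ltnS /n; lia.
have e1 : ('C(m + s, s) * (n * (m`! * (s.+1)`!)) = s.+1 * n`!)%N.
  rewrite /n !factS -(@bin_fact (m + s) s) ?leq_addl // addnK; ring.
have {}e1 : 'C(m + s, s)%:R * (n%:R * (m`!%:R * (s.+1)`!%:R)) = s.+1%:R * n`!%:R :> R.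
  by rewrite -!natrM e1.
have hn := exprn_le_fact R n; have hm := fact_le_exprn R m.
have hs := fact_le_exprn R s.+1.
have hma : m%:R ^+ m <= (n%:R / alpha) ^+ m.
  by rewrite lerXn2r ?nnegrE ?divr_ge0 ?(ltW a0) // ler_pdivlMr.
set C := 'C(m + s, s)%:R in e1 *.
have C0 : 0 <= C by [].
have hns : s.+1%:R * n%:R ^+ n <=
    C * (n%:R * ((expR 1 * m.+1%:R * m%:R ^+ m) * (expR 1 * s.+2%:R * s.+1%:R ^+ s.+1))).
  apply: (@le_trans _ _ (s.+1%:R * (expR n%:R * n`!%:R))); first by rewrite ler_wpM2l.
  rewrite mulrCA -e1.
  have -> : expR n%:R = expR m%:R * expR s.+1%:R :> R by rewrite -expRD -natrD addnS.
  have -> : expR m%:R * expR s.+1%:R * (C * (n%:R * (m`!%:R * (s.+1)`!%:R))) =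
    C * (n%:R * ((expR m%:R * m`!%:R) * (expR s.+1%:R * (s.+1)`!%:R))) by ring.
  rewrite ler_wpM2l // ler_wpM2l // ler_pM // mulr_ge0 ?expR_ge0 //.
have s0 : 0 < s.+1%:R :> R by [].
have {}hns : n%:R ^+ n <=
    expR 2 * n.+1%:R ^+ 3 * (n%:R / alpha) ^+ m * (C * s.+1%:R ^+ s).
  rewrite -(ler_pM2l s0); apply: le_trans hns _.
  have -> : C * (n%:R * ((expR 1 * m.+1%:R * m%:R ^+ m) *
                        (expR 1 * s.+2%:R * s.+1%:R ^+ s.+1))) =
    s.+1%:R * (expR 2 * (n%:R * m.+1%:R * s.+2%:R) * m%:R ^+ m * (C * s.+1%:R ^+ s)).
    by rewrite [_ ^+ s.+1]exprS (_ : 2 = 1 + 1) // expRD; ring.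
  rewrite ler_wpM2l // ler_wpM2r ?mulr_ge0 ?exprn_ge0 //.
  rewrite ler_pM ?mulr_ge0 ?exprn_ge0 ?expR_ge0 // ler_wpM2l ?expR_ge0 //.
  rewrite -!natrM -natrX ler_nat !expnS expn0 muln1 mulnA !leq_mul // /n; lia.
have ns : n%:R ^+ n = n%:R ^+ m * (n%:R ^+ s * n%:R) :> R.
  by rewrite -exprSr -exprD addnS.
have am0 : 0 < alpha ^+ m by rewrite exprn_gt0.
have nm0 : 0 < n%:R ^+ m :> R by rewrite exprn_gt0.
have nsp : 0 < n%:R ^+ s :> R by rewrite exprn_gt0.
have {}hns : alpha ^+ m * (n%:R ^+ s * n%:R) <=
    expR 2 * n.+1%:R ^+ 3 * (C * s.+1%:R ^+ s).
  rewrite -(ler_pM2l nm0) mulrCA -ns -ler_pdivlMl // (le_trans hns) //.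
  rewrite expr_div_n le_eqVlt; apply/orP; left; apply/eqP; field.
  by rewrite gt_eqF.
have as0 : 0 <= alpha ^+ s by rewrite exprn_ge0 // ltW.
have n1 : 1 <= n%:R :> R by rewrite ler1n.
apply: (@le_trans _ _ (alpha ^+ s * (alpha ^+ m * (n%:R ^+ s * n%:R)) / n%:R ^+ s)).
  rewrite ler_pdivlMr // exprD.
  have -> : alpha ^+ m * alpha ^+ s * n%:R ^+ s = (alpha ^+ s * (alpha ^+ m * n%:R ^+ s)) by ring.
  rewrite !mulrA ler_peMr // !mulr_ge0 // ltW //.
apply: (@le_trans _ _ (alpha ^+ s * (expR 2 * n.+1%:R ^+ 3 * (C * s.+1%:R ^+ s)) / n%:R ^+ s)).
  by rewrite ler_wpM2r ?invr_ge0 ?(ltW nsp) // ler_wpM2l.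
rewrite expr_div_n.
have -> : expR 2 * n.+1%:R ^+ 4 * (C * (alpha ^+ s / n%:R ^+ s) * (s.+1%:R ^+ s / s.+1%:R)) =
   alpha ^+ s * (expR 2 * n.+1%:R ^+ 3 * (C * s.+1%:R ^+ s)) / n%:R ^+ s * (n.+1%:R / s.+1%:R).
  by rewrite [n.+1%:R ^+ 4]exprSr; ring.
(* The fourth factor [n + 1] pays for the division by [s + 1]; the other three cover the Stirling
   losses. *)
have r1 : 1 <= n.+1%:R / s.+1%:R :> R.
  by rewrite ler_pdivlMr // mul1r ler_nat.
apply: ler_peMr r1; apply: mulr_ge0; last by rewrite invr_ge0 ltW.
by rewrite mulr_ge0 // mulr_ge0 ?mulr_ge0 ?exprn_ge0 ?expR_ge0.
Qed.

(** The tree of the first vertex takes [s] further vertices and contributes about [alpha ^ n]. The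
    other [m], about [y n / alpha], form a subcritical graph with [a = y] and contribute about
    [exp (n y ^ 2 / (2 alpha))], while [(1 - p) ^ C(n, 2)] gives [exp (- n alpha / 2)]. *)
Lemma prob_acyclic_ge_split (R : realType) (alpha y : R) (m s : nat) :
  1 <= alpha -> 0 < y < 1 -> 2 * alpha <= (m + s).+1%:R ->
  m%:R * alpha <= y * (m + s).+1%:R <= m.+1%:R * alpha ->
  expR ((m + s).+1%:R * (ln alpha - alpha / 2 + y ^+ 2 / (2 * alpha)) -
        (2 + ln alpha + alpha ^+ 2 + 3 / 2 + 2 * ((1 - y)^-1 + 2^-1))) <=
  (m + s).+2%:R ^+ 4 * prob_acyclic (m + s).+1 (alpha / (m + s).+1%:R).
Proof.
move=> a1 /andP[y0 y1] na /andP[mn nm].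
have a0 : 0 < alpha by apply: lt_le_trans a1.
set n := (m + s).+1 in na mn nm *.
have n0 : 0 < n%:R :> R by [].
have mna : m%:R * alpha <= n%:R by apply: le_trans mn _; rewrite ler_piMl // ltW.
have hC := bin_rooted_ge a1 mna; rewrite -/n in hC.
set p := alpha / n%:R in hC *.
have np : n%:R * p = alpha by rewrite /p mulrC divfK // gt_eqF.
have p0 : 0 < p by rewrite divr_gt0.
have p2 : p <= 2^-1 by rewrite ler_pdivrMr //; lra.
have my : m%:R * p <= y.
  by rewrite -(ler_pM2r n0) -mulrA [p * _]mulrC np.
clearbody p.
have p1 : p < 1 by lra.
have q0 : 0 < 1 - p by rewrite subr_gt0.
have qV2 : (1 - p)^-1 <= 2 by rewrite -[2]invrK lef_pV2 ?posrE //; lra.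
set x := p / (1 - p); have x0 : 0 < x by rewrite divr_gt0.
have xE : 1 + x = (1 - p)^-1 by exact: odds_shift.
have px : p <= x by rewrite ler_pdivlMr // ler_piMr ?(ltW p0) //; lra.
have xp : x = p * (1 + x) by rewrite xE.
have b0 : 0 < 1 - y by rewrite subr_gt0.
have hA : 1 <= 2 * ((2 * (1 - y))^-1) * (1 - y).
  by rewrite le_eqVlt; apply/orP; left; apply/eqP; field; rewrite gt_eqF.
have mx : m%:R * x <= y * (1 + x).
  by rewrite {1}xp mulrA ler_wpM2r // addr_ge0 // ltW.
have hm := forest_sum_ge_subcritical 0 (ltW x0) y1 hA mx.
have hs := @forest_sum_ge_rooted R x 1 s m (ltW x0) isT.
rewrite mul1r add1n in hs.
(* Here [x = alpha / (n - alpha)], and [n >= 2 alpha] keeps the excess of [x C(n, 2)] over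
   [n alpha / 2] below [alpha ^ 2]. *)
have h1 : expR (- (n%:R * alpha / 2 + alpha ^+ 2)) <= (1 - p) ^+ 'C(n, 2).
  have := expr1Dx_le_expR 'C(n, 2) (addr_ge0 ler01 (ltW x0)).
  rewrite xE exprVn expRN => h.
  rewrite -[X in _ <= X]invrK lef_pV2 ?posrE ?expR_gt0 ?invr_gt0 ?exprn_gt0 //.
  apply: le_trans h _; rewrite ler_expR bin2_natr.
  rewrite (_ : x * (n%:R * (n%:R - 1) / 2) = alpha * (n%:R * (n%:R - 1)) / (2 * (n%:R - alpha))).
    have na0 : 0 < 2 * (n%:R - alpha) by lra.
    rewrite ler_pdivrMr //.
    have : 0 <= (n%:R - 2 * alpha) * alpha by rewrite mulr_ge0 ?subr_ge0 ?(ltW a0).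
    have := n0; have := a0; move: (n%:R : R) => N; nra.
  rewrite /x -np; field; rewrite ?gt_eqF // -?np; nra.
have h2 : expR (n%:R * (y ^+ 2 / (2 * alpha)) - 3 / 2) <= (1 + x) ^+ 'C(m, 2).
  have := @expr1Dx_le_expR R (- p) 'C(m, 2) (ltW q0).
  rewrite mulNr expRN xE exprVn => h.
  rewrite -[X in X <= _]invrK lef_pV2 ?posrE ?invr_gt0 ?expR_gt0 ?exprn_gt0 //.
  apply: le_trans h _; rewrite lef_pV2 ?posrE ?expR_gt0 // ler_expR bin2_natr.
  (* Rounding [z] down to [m] costs at most [3 z] in [m (m - 1)], hence at most [3/2] in the
     exponent because [p z = y < 1]. *)
  pose z := y * n%:R / alpha.
  have mz : m%:R <= z by rewrite ler_pdivlMr.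
  have zm : z <= m%:R + 1 by rewrite natr1 ler_pdivrMr.
  have hz : z ^+ 2 - 3 * z <= m%:R * (m%:R - 1).
    have z0 : 0 <= z by rewrite divr_ge0 ?mulr_ge0 ?(ltW a0) ?(ltW y0).
    have [m0|m0] := posnP m; first by move: mz zm; rewrite m0; nra.
    have m1 : 1 <= m%:R :> R by rewrite ler1n.
    by nra.
  have pz : p * z = y by rewrite /z -np; field; rewrite !gt_eqF.
  have -> : n%:R * (y ^+ 2 / (2 * alpha)) = p * z ^+ 2 / 2.
    by rewrite /z -np; field; rewrite !gt_eqF.
  have := ler_wpM2l (ltW p0) hz; rewrite mulrBr [p * (3 * z)]mulrCA pz.
  by lra.
have h3 : x * (2 * (2 * (1 - y))^-1 + 2^-1) * m%:R <= 2 * ((1 - y)^-1 + 2^-1).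
  have -> : 2 * (2 * (1 - y))^-1 + 2^-1 = (1 - y)^-1 + 2^-1.
    by field; rewrite gt_eqF.
  rewrite mulrAC ler_wpM2r ?addr_ge0 ?invr_ge0 ?(ltW b0) // mulrC.
  apply: le_trans mx _; rewrite xE -[2]mul1r ler_pM ?invr_ge0 ?(ltW y0) ?(ltW q0) ?(ltW y1) //.
set B := 2 * (_^-1 + _) in h3 *.
have h4 : expR (n%:R * (y ^+ 2 / (2 * alpha)) - 3 / 2) * expR (- B) <= forest_sum x 0 m.
  apply: le_trans hm; rewrite mul0n add0n ler_pM ?expR_ge0 //.
  by rewrite ler_expR lerN2 expr0n /= mulr0 add0r mulrA.
set K := 'C(m + s, s)%:R * _ * _ in hC.
(* The first vertex becomes the single root, and [x ^ s >= p ^ s] brings in the weight used in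
   [bin_rooted_ge]. *)
have h5 : K * (expR (n%:R * (y ^+ 2 / (2 * alpha)) - 3 / 2) * expR (- B)) <=
    forest_sum x 0 n.
  rewrite forest_sum0S; apply: le_trans hs.
  have K0 : 0 <= s.+1%:R ^+ s / s.+1%:R :> R by rewrite divr_ge0 // exprn_ge0.
  rewrite ler_pM ?mulr_ge0 ?expR_ge0 ?exprn_ge0 ?(ltW p0) //.
  rewrite ler_wpM2r // ler_wpM2l // lerXn2r ?nnegrE ?(ltW p0) ?(ltW x0) //.
have K0 : 0 <= K.
  by rewrite !mulr_ge0 ?exprn_ge0 ?invr_ge0 ?(ltW p0).
rewrite prob_acyclicE // -/x.
apply: (@le_trans _ _ (n.+1%:R ^+ 4 * (expR (- (n%:R * alpha / 2 + alpha ^+ 2)) *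
  (K * (expR (n%:R * (y ^+ 2 / (2 * alpha)) - 3 / 2) * expR (- B)))))); last first.
  rewrite ler_wpM2l ?exprn_ge0 // ler_pM ?expR_ge0 //.
  by rewrite mulr_ge0 // mulr_ge0 ?expR_ge0.
have -> : n.+1%:R ^+ 4 * (expR (- (n%:R * alpha / 2 + alpha ^+ 2)) *
  (K * (expR (n%:R * (y ^+ 2 / (2 * alpha)) - 3 / 2) * expR (- B)))) =
  (expR 2 * n.+1%:R ^+ 4 * K) * (expR (- 2) * expR (- (n%:R * alpha / 2 + alpha ^+ 2)) *
  (expR (n%:R * (y ^+ 2 / (2 * alpha)) - 3 / 2) * expR (- B))).
  have e2 : expR 2 * expR (- 2) = 1 :> R by exact: expRxMexpNx_1.
  by rewrite -[LHS]mul1r -[X in X * _ = _]e2; ring.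
have la : alpha ^+ (m + s) = expR ((n%:R - 1) * ln alpha).
  by rewrite -[n%:R]natr1 addrK expRM_natl lnK.
apply: le_trans (ler_wpM2r _ hC); last by rewrite !mulr_ge0 ?expR_ge0.
rewrite la -!expRD ler_expR le_eqVlt; apply/orP; left; apply/eqP; ring.
Qed.

(** Take [m] to be the integer part of [y n / alpha]; it is less than [n] because
    [y < 1 <= alpha]. *)
Lemma prob_acyclic_ge_supercritical (R : realType) (alpha y : R) (n : nat) :
  1 <= alpha -> 0 < y < 1 -> 2 * alpha <= n%:R ->
  expR (n%:R * (ln alpha - alpha / 2 + y ^+ 2 / (2 * alpha)) -
        (2 + ln alpha + alpha ^+ 2 + 3 / 2 + 2 * ((1 - y)^-1 + 2^-1))) <=
  n.+1%:R ^+ 4 * prob_acyclic n (alpha / n%:R).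
Proof.
move=> a1 y01 na; have /andP[y0 y1] := y01.
have a0 : 0 < alpha by apply: lt_le_trans a1.
have n0 : 0 < n%:R :> R by apply: lt_le_trans na; rewrite mulr_gt0.
have z0 : 0 <= y * n%:R / alpha by rewrite divr_ge0 ?mulr_ge0 ?(ltW a0) ?(ltW y0).
have := truncn_itv z0; set m := Num.truncn _.
rewrite ler_pdivlMr // ltr_pdivrMr // => /andP[mn nm].
have lt_mn : (m < n)%N.
  rewrite -(ltr_nat R); apply: le_lt_trans (_ : m%:R * alpha < _).
    by rewrite ler_peMr.
  by apply: le_lt_trans mn _; rewrite gtr_pMl.
have ns : n = (m + (n.-1 - m)).+1 by lia.
clearbody m; move: (n.-1 - m)%N ns mn nm => s ns mn nm; rewrite ns in na mn nm *.
by apply: prob_acyclic_ge_split => //; rewrite mn (ltW nm).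
Qed.

(** * Passage to the limit *)

Local Open Scope classical_set_scope.

(** Eventually [ln (P n) / n] is within [eps + C / n] of [l], so [C] may depend on [eps]. *)
Lemma cvg_nth_root (R : realType) (P : nat -> R) (l : R) :
  (forall eps, 0 < eps -> exists C, \forall n \near \oo,
     expR (n%:R * (l - eps) - C) <= P n <= expR (n%:R * (l + eps) + C)) ->
  (fun n => P n `^ n%:R^-1) @ \oo --> expR l.
Proof.
move=> hP.
have cl : (fun n => ln (P n) / n%:R) @ \oo --> l.
  apply/cvgrPdist_le => eps eps0; have e2 : 0 < eps / 2 by rewrite divr_gt0.
  have [C hC] := hP _ e2.
  near=> n; have /andP[lo hi] : expR (n%:R * (l - eps / 2) - C) <= P n <=
    expR (n%:R * (l + eps / 2) + C) by near: n.
  have P0 : 0 < P n by apply: lt_le_trans lo; apply: expR_gt0.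
  have n0 : 0 < n%:R :> R by rewrite ltr0n; near: n; exact: nbhs_infty_gt.
  have nC : C / (eps / 2) <= n%:R by near: n; exact: nbhs_infty_ger.
  rewrite ler_pdivrMr // in nC.
  have PE : P n = expR (ln (P n)) by rewrite lnK.
  rewrite PE ler_expR in lo; rewrite PE ler_expR in hi.
  have -> : l - ln (P n) / n%:R = (l * n%:R - ln (P n)) / n%:R.
    by rewrite mulrBl mulfK // gt_eqF.
  rewrite normrM normfV (gtr0_norm n0) ler_pdivrMr // ler_norml.
  by apply/andP; split; lra.
have : (fun n => expR (ln (P n) / n%:R)) @ \oo --> expR l.
  by apply: continuous_cvg => //; apply: continuous_expR.
(* [powR] is the exponential of a logarithm only for a nonzero base; the lower bound for [eps = 1]
   makes [P n] eventually positive. *)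
apply: cvg_trans; apply: near_eq_cvg.
have [C hC] := hP _ ltr01.
near=> n; have /andP[lo _] : expR (n%:R * (l - 1) - C) <= P n <=
    expR (n%:R * (l + 1) + C) by near: n.
have P0 : 0 < P n by apply: lt_le_trans lo; apply: expR_gt0.
by rewrite /= /powR gt_eqF // mulrC.
Unshelve. all: by end_near.
Qed.

Theorem theorem2p3 (R : realType) (alpha : R) (halpha : 0 <= alpha) :
  ((fun n : nat => (prob_acyclic n (alpha / n%:R)) `^ (n%:R^-1)) : nat -> R) @ \oo -->
  ((if 1 < alpha then alpha * expR (- (alpha / 2) + (2 * alpha)^-1) else 1) : R).
Proof.
have [a1|a1] := ltP alpha 1.
  have -> : (if 1 < alpha then alpha * expR (- (alpha / 2) + (2 * alpha)^-1) else 1) =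
      expR 0 by rewrite ltNge (ltW a1) /= expR0.
  apply: cvg_nth_root => eps eps0.
  pose C := alpha / (1 - alpha) * ((1 - alpha)^-1 + 2^-1).
  exists C; near=> n; have n0 : (0 < n)%N by near: n; exact: nbhs_infty_gt.
  have ne : 0 <= n%:R * eps by rewrite mulr_ge0 // ltW.
  apply/andP; split.
    apply: le_trans (prob_acyclic_ge_subcritical (_ : 0 <= alpha < 1) n0).
      by rewrite ler_expR sub0r mulrN -/C; lra.
    by rewrite halpha.
  have b0 : 0 < 1 - alpha by rewrite subr_gt0.
  apply: (@le_trans _ _ 1).
    apply: prob_acyclic_le1; rewrite divr_ge0 //= ltr_pdivrMr ?ltr0n // mul1r.
    by apply: lt_le_trans a1 _; rewrite ler1n.
  rewrite -[X in X <= _](expR0 R) ler_expR add0r addr_ge0 // /C.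
  by rewrite mulr_ge0 // ?addr_ge0 ?divr_ge0 ?invr_ge0 // ltW.
have a0 : 0 < alpha by apply: lt_le_trans a1.
(* At [alpha = 1] the exponent on the right vanishes, so the critical case joins the supercritical
   one. *)
have -> : (if 1 < alpha then alpha * expR (- (alpha / 2) + (2 * alpha)^-1) else 1) =
    expR (ln alpha - alpha / 2 + (2 * alpha)^-1).
  case: ltgtP a1 => // [_ _|<- _]; first by rewrite -addrA [in RHS]expRD lnK.
  by rewrite ln1 mulr1 mul1r add0r addNr expR0.
(* With [y = 1 - d], replacing [y ^ 2] by 1 costs at most [2 d / (2 alpha) <= d <= eps / 2]; the cap
   [1/2] keeps [y] positive. *)
apply: cvg_nth_root => eps eps0; pose d := Num.min (eps / 2) 2^-1.
have d0 : 0 < d by rewrite lt_min; apply/andP; split; lra.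
have de : d <= eps / 2 by rewrite ge_min lexx.
have d2 : d <= 2^-1 by rewrite ge_min lexx orbT.
(* The lower bound carries [(n + 1) ^ 4], so the rate [eps / 8] is spent four times and uses the
   other [eps / 2]. *)
have e8 : 0 < eps / 8 by rewrite divr_gt0.
pose L := ln (1 + (eps / 8)^-1).
pose C1 := 2 + ln alpha + alpha ^+ 2 + 3 / 2 + 2 * ((1 - (1 - d))^-1 + 2^-1).
have L0 : 0 <= L by rewrite ln_ge0 // lerDl invr_ge0 ltW.
have la0 : 0 <= ln alpha by rewrite ln_ge0.
have C10 : 0 <= C1.
  have : 0 <= (1 - (1 - d))^-1 by rewrite subKr invr_ge0 ltW.
  have := sqr_ge0 alpha; rewrite /C1; lra.
exists (C1 + 4 * L + (1 + alpha * 3 / 2)); near=> n.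
have n2a : 2 * alpha <= n%:R by near: n; exact: nbhs_infty_ger.
have n3 : (3 <= n)%N by near: n; exact: nbhs_infty_ge.
have an : alpha < n%:R by lra.
have nn := @natr1_le_expR R (eps / 8) n e8; rewrite -/L in nn.
have n0 : 0 <= n%:R :> R by [].
have ne : 0 <= n%:R * eps by rewrite mulr_ge0 // ltW.
apply/andP; split; last first.
  apply: le_trans (prob_acyclic_le_supercritical a0 an n3) _.
  apply: le_trans (ler_wpM2r (expR_ge0 _) nn) _.
  by rewrite -expRD ler_expR; lra.
have y01 : 0 < 1 - d < 1 by rewrite subr_gt0 gtrBl d0 andbT; lra.
have := prob_acyclic_ge_supercritical a1 y01 n2a; rewrite -/C1 => hP.
have n4 : 0 < n.+1%:R ^+ 4 :> R by rewrite exprn_gt0.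
rewrite -(ler_pM2l n4); apply: le_trans hP.
have h4 : n.+1%:R ^+ 4 <= expR (4 * (L + eps / 8 * n%:R)) :> R.
  by rewrite expRM_natl lerXn2r ?nnegrE ?expR_ge0.
apply: le_trans (ler_wpM2r (expR_ge0 _) h4) _.
rewrite -expRD ler_expR.
have hy : (2 * alpha)^-1 - eps / 2 <= (1 - d) ^+ 2 / (2 * alpha).
  have i0 : 0 <= (2 * alpha)^-1 by rewrite invr_ge0 mulr_ge0 // ltW.
  have i1 : (2 * alpha)^-1 <= 2^-1 by rewrite lef_pV2 ?posrE ?mulr_gt0 //; lra.
  move: ((2 * alpha)^-1) i0 i1 => t t0 t1.
  have : d * t <= d * 2^-1 by rewrite ler_wpM2l // ltW.
  have : 0 <= d ^+ 2 * t by rewrite mulr_ge0 ?sqr_ge0.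
  by rewrite -/d; lra.
have := ler_wpM2l n0 hy; lra.
Unshelve. all: by end_near.
Qed.
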